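(* For all integers $D\geq 2$ and $\beta\geq 1$, the maximum order of a connected graph with diameter $D$ and metric dimension $\beta$ is $$\left(\left\lfloor\frac{2D}{3}\right\rfloor+1\right)^\beta+\beta\sum_{i=1}^{\lceil D/3\rceil}(2i-1)^{\beta-1}.$$
   Context: Graphs are finite, undirected and simple; the order of a graph is its number of vertices. A vertex $x$ of a connected graph $G$ resolves a pair of vertices $v,w$ if $\mathrm{dist}(v,x)\neq\mathrm{dist}(w,x)$. A set $S\subseteq V(G)$ is a resolving set of $G$ if every pair of distinct vertices of $G$ is resolved by some vertex in $S$. The metric dimension of $G$ is the minimum cardinality of a resolving set of $G$. *)

(* Defs.v *)
From mathcomp Require Import all_boot.

Set Implicit Arguments.
Unset Strict Implicit.
Unset Printing Implicit Defensive.

Record sgraph := SGraph {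
  vertex :> finType;
  adj : rel vertex;
  adj_sym : symmetric adj;
  adj_irr : irreflexive adj }.

Section MetricDimension.

Variable G : sgraph.
Implicit Types (v w x y : G) (S : {set G}).

Definition connected : bool := [forall x, forall y, connect (@adj G) x y].

Definition walk (n : nat) x y : bool :=
  [exists p : n.-tuple G, path (@adj G) x p && (last x p == y)].

(* The least length of a walk from x to y.  If y is reachable from x then a
   shortest walk repeats no vertex, so its length is below #|G|; the default
   value #|G| is taken exactly when y is unreachable from x. *)
Definition dist x y : nat := \big[minn/#|G|]_(n < #|G| | walk n x y) n.

Definition diameter : nat := \max_(x : G) \max_(y : G) dist x y.

Definition resolves x v w : bool := dist v x != dist w x.

Definition resolving_set S : bool :=
  [forall v, forall w, (v != w) ==> [exists x in S, resolves x v w]].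

(* The whole vertex set is always resolving, so the default value #|G| does
   not affect the minimum. *)
Definition metric_dim : nat :=
  \big[minn/#|G|]_(S : {set G} | resolving_set S) #|S|.

End MetricDimension.

Definition in_class (D beta : nat) (G : sgraph) : Prop :=
  [/\ connected G, diameter G = D & metric_dim G = beta].

Definition is_max_order (C : sgraph -> Prop) (N : nat) : Prop :=
  (exists2 G, C G & #|G| = N) /\ (forall G, C G -> #|G| <= N).

(* The ceiling of m / d, for d > 0. *)
Definition ceil_div (m d : nat) : nat := (m + d.-1) %/ d.

(* Main.v *)
(* Send each vertex to its vector of distances to a resolving set of size b.
   With A = ceil(D / 3), either all b coordinates are at least A, or the vertex
   is at distance t < A from some landmark v; in that case its distance to any
   other landmark u differs from dist v u by at most t.  Counting vectors gives
   the upper bound.  For equality take all vectors in [0, D]^b compatible with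
   landmarks pairwise at distance B = floor(D / 3) + A, adjacent when they
   differ by at most 1 in each coordinate: graph distance is then the
   l_infinity distance.  That fewer than b landmarks cannot resolve this graph
   follows from the upper bound itself, which is strictly increasing in b. *)

Require Import Defs.
From mathcomp Require Import all_boot.
From mathcomp Require Import zify.

Set Implicit Arguments.
Unset Strict Implicit.
Unset Printing Implicit Defensive.

(** * Minima with a default value, and counting in finite types *)

Section BigMin.

Variables (I : finType) (P : pred I) (F : I -> nat) (d : nat).

Lemma bigmin_leq_default : \big[minn/d]_(i | P i) F i <= d.
Proof. by elim/big_rec: _ => // i m _ le_md; rewrite geq_min le_md orbT. Qed.

Lemma bigmin_leq i : P i -> \big[minn/d]_(i | P i) F i <= F i.
Proof.
move=> Pi; have : i \in index_enum I by rewrite mem_index_enum.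
elim: (index_enum I) => // j r IHr; rewrite inE big_cons.
case/predU1P => [<-|/IHr le_r]; first by rewrite Pi geq_minl.
by case: ifP => // _; rewrite geq_min le_r orbT.
Qed.

Lemma bigmin_attained :
  \big[minn/d]_(i | P i) F i = d \/
  exists2 i, P i & \big[minn/d]_(i | P i) F i = F i.
Proof.
elim/big_rec: _ => [|i m Pi IH]; first by left.
rewrite /minn; case: ifP => _; first by right; exists i.
by [].
Qed.

End BigMin.

Lemma leq_card_bigcup (T I : finType) (F : I -> {set T}) :
  #|\bigcup_i F i| <= \sum_i #|F i|.
Proof.
elim/big_ind2: _ => [|A m B n Am Bn|//]; first by rewrite cards0.
by apply: leq_trans (leq_add Am Bn); exact: leq_card_setU.
Qed.

Lemma card_ord_itv n a e : #|[pred y : 'I_n | a <= y < e]| = minn e n - a.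
Proof.
rewrite -sum1_card big_mkcond /=.
elim: n => [|n IHn]; first by rewrite big_ord0; lia.
rewrite big_ord_recr /= IHn; case: ifP; rewrite inE /=; lia.
Qed.

Lemma card_ffun_family (aT rT : finType) (F : aT -> pred rT) :
  #|[set f : {ffun aT -> rT} | [forall x, F x (f x)]]| = \prod_x #|F x|.
Proof.
rewrite cardsE -[LHS]/(#|family F|) card_family.
by rewrite foldrE big_map big_enum.
Qed.

(** * Walks, distances and resolving sets *)

Section Distance.

Variable G : sgraph.
Implicit Types (x y z : G).

Lemma walkP n x y :
  reflect (exists p, [/\ path (@adj G) x p, last x p = y & size p = n])
          (walk n x y).
Proof.
apply: (iffP existsP) => [[p /andP[xp /eqP <-]]|[p [xp <- sz_p]]].
  by exists p; rewrite size_tuple.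
by exists (tcast sz_p (in_tuple p)); rewrite val_tcast /= xp eqxx.
Qed.

Lemma walk_cat m n x y z : walk m x y -> walk n y z -> walk (m + n) x z.
Proof.
move=> /walkP[p [xp yE <-]] /walkP[q [yq zE <-]]; apply/walkP; exists (p ++ q).
by rewrite cat_path last_cat size_cat xp yE yq zE.
Qed.

Lemma walk_sym n x y : walk n x y -> walk n y x.
Proof.
move=> /walkP[p [xp yE <-]]; apply/walkP; exists (rev (belast x p)).
rewrite size_rev size_belast -yE rev_path; split=> //.
  by rewrite (eq_path (e' := @adj G)) // => u v; rewrite /= adj_sym.
by case: p {xp yE} => //= a p; rewrite rev_cons last_rcons.
Qed.

Lemma dist_leq n x y : walk n x y -> dist x y <= n.
Proof.
move=> xy; case: (ltnP n #|G|) => [ltnG|].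
  exact: (bigmin_leq (i := Ordinal ltnG) _ _ xy).
by apply: leq_trans; exact: bigmin_leq_default.
Qed.

Hypothesis conG : connected G.

Lemma walk_dist x y : walk (dist x y) x y.
Proof.
have /connectP[p0 xp0 yE0] : connect (@adj G) x y by move/forallP/(_ x)/forallP: conG.
have [p [xp uniq_p yE]] : exists p,
    [/\ path (@adj G) x p, uniq (x :: p) & last x p = y].
  by rewrite yE0; case: (shortenP xp0) => p xp uniq_p _; exists p.
have lt_pG : size p < #|G|.
  by move/card_uniqP: uniq_p => /= <-; exact: max_card.
have xy : walk (size p) x y by apply/walkP; exists p.
rewrite /dist; case: (bigmin_attained (fun n : 'I_#|G| => walk n x y)
  (@nat_of_ord _) #|G|) => [dE|[n w ->] //].
by have := dist_leq xy; rewrite /dist dE leqNgt lt_pG.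
Qed.

Lemma dist_triangle x y z : dist x z <= dist x y + dist y z.
Proof. by apply: dist_leq; apply: walk_cat (walk_dist _ _) (walk_dist _ _). Qed.

Lemma distC x y : dist x y = dist y x.
Proof. by apply/eqP; rewrite eqn_leq !dist_leq // walk_sym // walk_dist. Qed.

Lemma distxx x : dist x x = 0.
Proof. by apply/eqP; rewrite -leqn0; apply: dist_leq; apply/walkP; exists [::]. Qed.

Lemma dist_leq_diameter x y : dist x y <= diameter G.
Proof.
apply: leq_trans (leq_bigmax_cond x _) => //.
exact: (leq_bigmax_cond (F := fun y => dist x y) y).
Qed.

Lemma metric_dim_attained : exists2 S : {set G}, resolving_set S & #|S| = metric_dim G.
Proof.
rewrite /metric_dim; case: (bigmin_attained (@resolving_set G)
  (fun S : {set G} => #|S|) #|G|) => [->|[S rS ->]]; last by exists S.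
(* If the minimum is the default [#|G|], the full vertex set attains it: [v] itself resolves [v] and
   [w], as distance 0 forces equality. *)
exists [set: G]; last by rewrite cardsT.
apply/forallP => v; apply/forallP => w; apply/implyP => neq_vw.
apply/existsP; exists v; rewrite inE /resolves distxx.
apply: contraNneq neq_vw => d0; move: (walk_dist w v); rewrite -d0.
by case/walkP => p [_ <- /size0nil ->].
Qed.

End Distance.

(** * Counting distance vectors *)

Section Boxes.

Variables b D A : nat.

Definition far : {set {ffun 'I_b -> 'I_D.+1}} :=
  [set f : {ffun 'I_b -> 'I_D.+1} | [forall i, A <= f i]].

(** An index [k = (i, t)] stands for distance [t] to landmark [i]. With [c] the distances between
    landmarks, the triangle inequality confines every other coordinate to an interval of radius
    [t]. *)
Definition slab (c : 'I_b -> 'I_b -> nat) (k : 'I_b * 'I_A) :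
    {set {ffun 'I_b -> 'I_D.+1}} :=
  [set f : {ffun 'I_b -> 'I_D.+1} |
    [forall j, if j == k.1 then f j == k.2 :> nat
               else c k.1 j - k.2 <= f j < (c k.1 j + k.2).+1]].

Lemma card_far : #|far| = (D.+1 - A) ^ b.
Proof.
rewrite (card_ffun_family (fun _ => [pred y : 'I_D.+1 | A <= y])).
rewrite prod_nat_const card_ord; congr (_ ^ _).
rewrite -[D.+1 in RHS]minnn -card_ord_itv.
by apply: eq_card => y; rewrite !inE ltn_ord andbT.
Qed.

Lemma card_slab c (k : 'I_b * 'I_A) : #|slab c k| =
  (minn k.2.+1 D.+1 - k.2) * \prod_(j | j != k.1)
     (minn (c k.1 j + k.2).+1 D.+1 - (c k.1 j - k.2)).
Proof.
rewrite (card_ffun_family (fun j => [pred y : 'I_D.+1 |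
  if j == k.1 then y == k.2 :> nat
  else c k.1 j - k.2 <= y < (c k.1 j + k.2).+1])) (bigD1 k.1) //=.
congr (_ * _).
  by rewrite -card_ord_itv; apply: eq_card => y; rewrite !inE eqxx; lia.
apply: eq_bigr => j /negPf jk; rewrite -card_ord_itv.
by apply: eq_card => y; rewrite !inE jk.
Qed.

Lemma card_ord_predC1 (i : 'I_b) : #|[pred j | j != i]| = b - 1.
Proof. by rewrite -[LHS]/#|predC1 i| cardC1 card_ord subn1. Qed.

Lemma card_slab_leq c (k : 'I_b * 'I_A) : #|slab c k| <= (2 * k.2 + 1) ^ (b - 1).
Proof.
rewrite card_slab -(card_ord_predC1 k.1) -prod_nat_const -[leqRHS]mul1n.
apply: leq_mul; first by lia.
by apply: leq_prod => j _; lia.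
Qed.

(** The condition on [c] keeps every interval from being cut off at 0 or [D], so each has exactly
    [2 * k.2 + 1] elements. *)
Lemma card_slab_eq c (k : 'I_b * 'I_A) :
  A <= D.+1 ->
  (forall j, j != k.1 -> k.2 <= c k.1 j /\ c k.1 j + k.2 <= D) ->
  #|slab c k| = (2 * k.2 + 1) ^ (b - 1).
Proof.
move=> leAD cP; rewrite card_slab -(card_ord_predC1 k.1) -prod_nat_const.
rewrite (_ : minn _ _ - _ = 1); last by have := ltn_ord k.2; lia.
by rewrite mul1n; apply: eq_bigr => j /cP[]; lia.
Qed.

Lemma sum_slabs : \sum_(k : 'I_b * 'I_A) (2 * k.2 + 1) ^ (b - 1) =
  b * \sum_(1 <= i < A.+1) (2 * i - 1) ^ (b - 1).
Proof.
rewrite -(pair_bigA _ (fun (_ : 'I_b) (t : 'I_A) => (2 * t + 1) ^ (b - 1))) /=.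
rewrite sum_nat_const card_ord big_add1 /= big_mkord; congr (_ * _).
by apply: eq_bigr => i _; congr (_ ^ _); lia.
Qed.

Lemma leq_card_far_slabs c (W : {set {ffun 'I_b -> 'I_D.+1}}) :
  W \subset far :|: \bigcup_k slab c k ->
  #|W| <= (D.+1 - A) ^ b
          + b * \sum_(1 <= i < A.+1) (2 * i - 1) ^ (b - 1).
Proof.
move=> /subset_leq_card /leq_trans; apply.
apply: leq_trans (leq_card_setU _ _) _; rewrite card_far leq_add2l -sum_slabs.
by apply: leq_trans (leq_card_bigcup _) _; apply: leq_sum => k _; exact: card_slab_leq.
Qed.

End Boxes.

(** * The order formula and the upper bound *)

Definition max_order_formula D b :=
  ((2 * D) %/ 3 + 1) ^ b
  + b * \sum_(1 <= i < (ceil_div D 3).+1) (2 * i - 1) ^ (b - 1).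

(** Since floor(2D/3) + ceil(D/3) = D, the first base counts the values in [A, D] for A =
    ceil(D/3). *)
Lemma max_order_formulaE D b :
  max_order_formula D b = (D.+1 - ceil_div D 3) ^ b
  + b * \sum_(1 <= i < (ceil_div D 3).+1) (2 * i - 1) ^ (b - 1).
Proof. by rewrite /max_order_formula /ceil_div; congr (_ ^ _ + _); lia. Qed.

(** For [2 <= D] the first base is at least 2, which gives strict growth; the second summand does
    not decrease. *)
Lemma max_order_formula_lt D b b' :
  2 <= D -> b < b' -> max_order_formula D b < max_order_formula D b'.
Proof.
move=> D2 ltb; rewrite /max_order_formula -addSn leq_add //.
  by rewrite ltn_exp2l //; lia.
rewrite leq_mul ?(ltnW ltb) // big_nat [leqRHS]big_nat.
by apply: leq_sum => i /andP[i1 _]; rewrite leq_pexp2l //; lia.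
Qed.

Lemma order_leq_resolving (G : sgraph) (S : {set G}) :
  connected G -> resolving_set S ->
  #|G| <= max_order_formula (diameter G) #|S|.
Proof.
move=> conG rS; rewrite max_order_formulaE.
set D := diameter G; set A := ceil_div D 3.
pose v := @enum_val _ (mem S).
pose f (x : G) : {ffun 'I_#|S| -> 'I_D.+1} := [ffun i => inord (dist x (v i))].
have fE x i : f x i = dist x (v i) :> nat.
  by rewrite ffunE inordK // ltnS dist_leq_diameter.
have f_inj : injective f.
  move=> x y fxy; apply/eqP; apply: contraT => neq_xy.
  have /existsP[s /andP[sS /negP[]]] := implyP (forallP (forallP rS x) y) neq_xy.
  have -> : s = v (enum_rank_in sS s) by rewrite /v enum_rankK_in.
  by rewrite -!fE fxy.
rewrite -cardsT -(card_imset _ f_inj).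
apply: (leq_card_far_slabs (c := fun i j => dist (v i) (v j))).
apply/subsetP => _ /imsetP[x _ ->]; rewrite !inE.
case: forallP => //= /forallP/forallPn[i]; rewrite -ltnNge => lt_iA.
apply/bigcupP; exists (i, Ordinal lt_iA) => //; rewrite inE.
apply/forallP => j /=; case: eqP => [->//|_]; rewrite !fE.
(* Together these bound the difference of [dist x (v j)] and [dist (v i) (v j)] by [dist x (v i)],
   the slab radius. *)
have := dist_triangle conG x (v i) (v j).
have := dist_triangle conG (v i) x (v j).
by rewrite (distC conG (v i) x); lia.
Qed.

(** * The extremal graph and its distances *)

Section Extremal.

Variables D b : nat.
Hypothesis D2 : 2 <= D.

Let A := ceil_div D 3.
Let B := D %/ 3 + A.

(* The conditions say |f j - B| <= f i: f satisfies the triangle inequality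
   with landmarks at mutual distance B.  This is the union of [far] and of all
   slabs centred at B, but a conjunction of two-variable constraints is easier
   to preserve along a walk. *)
Definition hub_close : pred {ffun 'I_b -> 'I_D.+1} := fun f =>
  [forall i, forall j, (i != j) ==> (B <= f i + f j) && (f j <= B + f i)].

Definition xvertex : finType := {f | hub_close f}.

Definition coords (f : xvertex) : {ffun 'I_b -> 'I_D.+1} := val f.

Definition of_coords f (hub_f : hub_close f) : xvertex := Sub f hub_f.

Lemma of_coordsK f (hub_f : hub_close f) : coords (of_coords hub_f) = f.
Proof. exact: SubK. Qed.

Lemma coords_inj : injective coords.
Proof. exact: val_inj. Qed.

Lemma coords_close f : hub_close (coords f).
Proof. exact: valP. Qed.

Definition xadj : rel xvertex := fun f g => (f != g) &&
  [forall i, (coords f i <= (coords g i).+1) && (coords g i <= (coords f i).+1)].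

Lemma xadj_sym : symmetric xadj.
Proof.
by move=> f g; rewrite /xadj eq_sym; congr (_ && _); apply: eq_forallb => i; rewrite andbC.
Qed.

Lemma xadj_irr : irreflexive xadj.
Proof. by move=> f; rewrite /xadj eqxx. Qed.

Definition xgraph : sgraph := SGraph xadj_sym xadj_irr.

Lemma hub_closeP (f : {ffun 'I_b -> 'I_D.+1}) :
  reflect (forall i j, i != j -> B <= f i + f j /\ f j <= B + f i) (hub_close f).
Proof.
apply: (iffP forallP) => [H i j ij|H i].
  by have /implyP/(_ ij)/andP := forallP (H i) j.
by apply/forallP => j; apply/implyP => /H[-> ->].
Qed.

(** These explain the choice of [B]: for [t < A] the interval [B - t, B + t] stays inside [A, D], so
    slabs centred at [B] are not truncated and meet neither [far] nor each other. *)
Lemma hub_bounds :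
  [/\ B <= D, A <= D.+1, D <= B + A, A <= B
    & forall t, t < A -> A <= B - t /\ B + t <= D].
Proof. by rewrite /B /A /ceil_div; split; last move=> t; lia. Qed.

(** Induction on [n]: a vertex [h] equal or adjacent to [f] is within [n] of [g] in every
    coordinate. *)
Lemma xdist_close n (f g : xgraph) :
  (forall i, coords f i <= coords g i + n /\ coords g i <= coords f i + n) ->
  exists2 m, m <= n & walk m f g.
Proof.
elim: n f => [|n IHn] f fg.
  exists 0 => //; apply/walkP; exists [::]; split=> //=.
  by apply/coords_inj/ffunP => i; apply/val_inj => /=; have [] := fg i; lia.
have [leBD _ _ _ _] := hub_bounds.
(* The largest vector within 1 of f and within n of g; being largest, it keeps
   the lower bounds on sums of coordinates. *)
pose h : {ffun 'I_b -> 'I_D.+1} :=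
  [ffun i => inord (minn (minn (coords f i).+1 (coords g i + n)) D)].
have hE i : h i = minn (minn (coords f i).+1 (coords g i + n)) D :> nat.
  by rewrite ffunE inordK // ltnS geq_minr.
have hP : hub_close h.
  apply/hub_closeP => i j ij; rewrite !hE.
  (* Difference bounds pass to coordinatewise minima. In a mixed sum, [f i + 1 + (g j + n)] is at
     least [f i + f j], as [f j <= g j + n + 1]. *)
  have [] := hub_closeP _ (coords_close f) i j ij; have [] := hub_closeP _ (coords_close g) i j ij.
  have := fg i; have := fg j.
  have := ltn_ord (coords f i); have := ltn_ord (coords f j).
  by have := ltn_ord (coords g i); have := ltn_ord (coords g j); lia.
have [|m lemn hg] := IHn (of_coords hP : xgraph).
  move=> i; rewrite of_coordsK hE; have := fg i.
  by have := ltn_ord (coords f i); have := ltn_ord (coords g i); lia.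
(* An idle step is not an edge, hence [m <= n] and not equality in the statement. *)
case: (eqVneq f (of_coords hP)) => [->|neq_fh]; first by exists m => //; exact: leqW.
exists m.+1 => //; rewrite -add1n; apply: walk_cat hg; apply/walkP.
exists [:: (of_coords hP : xgraph)]; split=> //=; rewrite andbT /xadj neq_fh /=.
apply/forallP => i; rewrite hE; have := fg i.
by have := ltn_ord (coords f i); have := ltn_ord (coords g i); lia.
Qed.

Lemma xgraph_connected : connected xgraph.
Proof.
apply/forallP => f; apply/forallP => g.
have [|m _ /walkP[p [fp gE _]]] := @xdist_close D f g; last by apply/connectP; exists p.
by move=> i; have := ltn_ord (coords f i); have := ltn_ord (coords g i); lia.
Qed.

Lemma coord_leq_walk n (f g : xgraph) i : walk n f g -> coords g i <= coords f i + n.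
Proof.
case/walkP => p [fp <- <-] {n g}; elim: p f fp => [|h p IHp] f /=; first by rewrite addn0.
case/andP => /andP[_ /forallP/(_ i)/andP[_ le_hf]] /IHp/leq_trans; apply.
by rewrite addnS -addSn leq_add2r.
Qed.

Lemma coord_leq_dist (f g : xgraph) i : coords g i <= coords f i + dist f g.
Proof. exact/coord_leq_walk/walk_dist/xgraph_connected. Qed.

Lemma xdist_leq n (f g : xgraph) :
  (forall i, coords f i <= coords g i + n /\ coords g i <= coords f i + n) -> dist f g <= n.
Proof. by move=> /xdist_close[m lemn /dist_leq/leq_trans]; apply. Qed.

Definition landmark_coords (i : 'I_b) : {ffun 'I_b -> 'I_D.+1} :=
  [ffun j => inord (if j == i then 0 else B)].

Lemma landmark_coordsE i j : landmark_coords i j = (if j == i then 0 else B) :> nat.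
Proof.
by rewrite ffunE inordK //; case: ifP => // _; have [] := hub_bounds; lia.
Qed.

Lemma landmark_coords_close i : hub_close (landmark_coords i).
Proof.
apply/hub_closeP => j k; rewrite !landmark_coordsE.
by case: (eqVneq j i) => [->|_]; case: (eqVneq k i) => [kE|_]; rewrite ?kE ?eqxx //; lia.
Qed.

Definition landmark i : xgraph := of_coords (landmark_coords_close i).

(** Being [hub_close] puts each [f j] with [j != i] within [f i] of [B], so [f] and the landmark
    differ by at most [f i] in every coordinate; coordinate [i] itself gives the converse. *)
Lemma dist_landmark (f : xgraph) i : dist f (landmark i) = coords f i.
Proof.
apply/eqP; rewrite eqn_leq; apply/andP; split.
  apply: xdist_leq => j; rewrite /landmark of_coordsK landmark_coordsE.
  case: eqP => [->|/eqP ji]; first by lia.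
  by have [] := hub_closeP _ (coords_close f) j i ji; have [] := hub_closeP _ (coords_close f) i j;
    rewrite 1?eq_sym //; lia.
have := coord_leq_dist (landmark i) f i.
by rewrite /landmark of_coordsK landmark_coordsE eqxx (distC xgraph_connected).
Qed.

Lemma landmarks_resolving : resolving_set [set landmark i | i : 'I_b].
Proof.
apply/forallP => f; apply/forallP => g; apply/implyP => neq_fg.
have /existsP[i neq_i] : [exists i, coords f i != coords g i].
  apply: contraT => /existsPn H; case/eqP: neq_fg; apply/coords_inj/ffunP => i.
  by apply/eqP; have := H i; rewrite negbK.
apply/existsP; exists (landmark i); rewrite imset_f //= /resolves.
by rewrite !dist_landmark.
Qed.

(** * Order of the extremal graph *)

Lemma far_or_slab_close :
  far b D A :|: \bigcup_(k : 'I_b * 'I_A) slab D (fun _ _ => B) k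
    \subset [set f | hub_close f].
Proof.
have [leBD _ leDBA leAB ltA] := hub_bounds.
(* With [D <= B + A], this makes any two coordinates in [A, D] compatible; only pairs involving the
   centre of a slab remain. *)
have AAB : B <= A + A by rewrite /B /A /ceil_div; lia.
apply/subsetP => f; rewrite !inE => /orP[/forallP farf|/bigcupP[[i t] _]].
  apply/hub_closeP => i j _; have := farf i; have := farf j.
  by move: (f i) (f j) => y z; have := ltn_ord z; lia.
rewrite inE /= => /forallP slabf; apply/hub_closeP => j k jk.
have [] := ltA t (ltn_ord t); have := ltn_ord t; move: jk (slabf j) (slabf k).
move: (f j) (f k) => y z; have := ltn_ord z.
case: (eqVneq j i) => [->|_]; first by rewrite [k == i]eq_sym => ? /negPf ->; lia.
by case: (eqVneq k i) => [kE|_]; lia.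
Qed.

Lemma order_xgraph_geq : max_order_formula D b <= #|xgraph|.
Proof.
have [leBD leAD leDBA leAB ltA] := hub_bounds.
rewrite [#|_|]card_sig -cardsE; apply: leq_trans (subset_leq_card far_or_slab_close).
(* A slab vector is below [A] exactly at its centre, so it is not in [far] and it determines the
   centre; its value there determines the radius. *)
have slabP (k : 'I_b * 'I_A) f j :
    f \in slab D (fun _ _ => B) k -> (f j < A) = (j == k.1).
  rewrite inE => /forallP/(_ j); have := ltn_ord k.2; have := ltA k.2 (ltn_ord k.2).
  by move: (f j) => y; case: (j == k.1); lia.
rewrite max_order_formulaE -/A; set slabs := \bigcup_(k : _) _.
have /eqP -> : #|far b D A :|: slabs| == #|far b D A| + #|slabs|.
  rewrite (leq_card_setU _ _).2 -setI_eq0; apply/eqP/setP => f; rewrite !inE.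
  apply/negP => /andP[/forallP farf /bigcupP[k _ fk]].
  by have := slabP k f k.1 fk; rewrite eqxx ltnNge farf.
rewrite card_far leq_add2l -sum_slabs -[leqRHS]sum1_card partition_disjoint_bigcup.
  rewrite leq_sum // => k _; rewrite sum1_card card_slab_eq // => j _.
  have ltkA := ltn_ord k.2; have [_ leBk] := ltA _ ltkA; split=> //.
  exact: leq_trans (ltnW ltkA) leAB.
move=> k l; apply: contraR => /pred0Pn[f /= /andP[fk fl]].
have kl1 : k.1 = l.1.
  by apply/eqP; rewrite -(slabP l f) // (slabP k f) ?eqxx.
apply/eqP; case: k l kl1 fk fl => [i s] [j t] /= -> ; rewrite !inE.
move=> /forallP/(_ j) + /forallP/(_ j) /=; rewrite eqxx => /eqP fs /eqP ft.
by congr (_, _); apply/val_inj; rewrite /= -fs -ft.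
Qed.

(** * Diameter and metric dimension of the extremal graph *)

Hypothesis b1 : 1 <= b.

Lemma diameter_xgraph : diameter xgraph = D.
Proof.
have [leBD leAD leDBA leAB ltA] := hub_bounds.
apply/eqP; rewrite eqn_leq; apply/andP; split.
  apply/bigmax_leqP => f _; apply/bigmax_leqP => g _; apply: xdist_leq => i.
  by have := ltn_ord (coords f i); have := ltn_ord (coords g i); lia.
(* The constant vector [D] is at distance [D] from every landmark. *)
have topP : hub_close [ffun=> ord_max].
  by apply/hub_closeP => i j _; rewrite !ffunE /=; lia.
apply: leq_trans (dist_leq_diameter (of_coords topP : xgraph) (landmark (Ordinal b1))).
by rewrite dist_landmark of_coordsK ffunE.
Qed.

Lemma metric_dim_xgraph : metric_dim xgraph = b.
Proof.
apply/eqP; rewrite eqn_leq; apply/andP; split.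
  apply: leq_trans (bigmin_leq _ _ landmarks_resolving) _.
  by rewrite -[leqRHS]card_ord leq_imset_card.
have [S rS <-] := metric_dim_attained xgraph_connected.
rewrite leqNgt; apply/negP => /(max_order_formula_lt D2); apply/negP; rewrite -leqNgt.
apply: leq_trans order_xgraph_geq _.
by rewrite -[in leqRHS]diameter_xgraph order_leq_resolving // xgraph_connected.
Qed.

End Extremal.

Theorem theorem3p1 (D beta : nat) (hD : 2 <= D) (hbeta : 1 <= beta) :
  is_max_order (in_class D beta)
    (((2 * D) %/ 3 + 1) ^ beta
     + beta * \sum_(1 <= i < (ceil_div D 3).+1) (2 * i - 1) ^ (beta - 1)).
Proof.
rewrite -/(max_order_formula D beta).
have order_leq G : in_class D beta G -> #|G| <= max_order_formula D beta.
  case=> conG diamG dimG; have [S rS cardS] := metric_dim_attained conG.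
  by rewrite -diamG -dimG -cardS order_leq_resolving.
split=> //; have xG : in_class D beta (xgraph D beta).
  by split; [exact: xgraph_connected | exact: diameter_xgraph | exact: metric_dim_xgraph].
exists (xgraph D beta) => //; apply/eqP.
by rewrite eqn_leq order_leq // order_xgraph_geq.
Qed.
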